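(* For every $n\in\mathbb{N}$ and $k\in[n]$, $$P_n^{\text{park}}(\sigma^{-1}_n=k)=\frac1n\,k^k\binom nk\frac{(n-k+1)^{n-k-1}}{(n+1)^{n-1}}.$$
   Context: $[n]=\{1,\dots,n\}$ and $S_n$ is the set of permutations $\sigma=\sigma_1\cdots\sigma_n$ of $[n]$; $\sigma^{-1}_k=j$ if and only if $\sigma_j=k$. Parking: cars $1,\dots,n$ arrive in this order on a one-way street with spaces $1,\dots,n$; given a sequence $\pi=(\pi_1,\dots,\pi_n)\in[n]^n$ of preferred spaces, car $i$ parks in space $\pi_i$ if it is free, and otherwise in the first free space with number greater than $\pi_i$, if one exists (if none exists the car exits the street). $\pi$ is a parking function on $[n]$ if all $n$ cars are able to park; $\mathcal{P}_n$ is the set of parking functions on $[n]$. The map $T_n:\mathcal{P}_n\to S_n$ is $T_n(\pi)=\sigma$, where $\sigma_j$ is the number of the car that parked in space $j$, $j\in[n]$. The probability measure $P_n^{\text{park}}$ on $S_n$ is $P_n^{\text{park}}(\sigma)=|T_n^{-1}(\{\sigma\})|/|\mathcal{P}_n|$. *)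

(* Defs.v *)
From mathcomp Require Import all_boot all_order all_fingroup all_algebra.

Set Implicit Arguments.
Unset Strict Implicit.
Unset Printing Implicit Defensive.

Import Order.TTheory GRing.Theory Num.Theory.

Local Open Scope ring_scope.

(* Cars and spaces, both numbered 1, ..., n in the mathematics, are elements  *)
(* of 'I_n: the ordinal i carries the number [label i] = i + 1.               *)
Definition label n (i : 'I_n) : nat := i.+1.

Fact top_subproof n : (0 < n)%N -> (n.-1 < n)%N.
Proof. by case: n. Qed.

(* The element of 'I_n whose label is n. *)
Definition top n (n_gt0 : (0 < n)%N) : 'I_n := Ordinal (top_subproof n_gt0).

Lemma label_top n (n_gt0 : (0 < n)%N) : label (top n_gt0) = n.
Proof. by rewrite /label /= prednK. Qed.

Section Parking.

Variable n : nat.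

(* st j = Some i if car i stands in space j, and None if space j is free. *)
Definition street := {ffun 'I_n -> option 'I_n}.

Definition preferences := {ffun 'I_n -> 'I_n}.

(* [enum 'I_n] is increasing: [ohead] selects the first free space beyond p, *)
(* and [outcome] below folds over the cars in order of arrival.              *)
Definition target (st : street) (p : 'I_n) : option 'I_n :=
  if st p == None then Some p
  else ohead [seq j <- enum 'I_n | (st j == None) && (p < j)%N].

Definition arrive (f : preferences) (st : street) (i : 'I_n) : street :=
  if target st (f i) is Some j then
    [ffun j' => if j' == j then Some i else st j']
  else st.

Definition outcome (f : preferences) : street :=
  foldl (arrive f) [ffun=> None] (enum 'I_n).

Definition is_parking (f : preferences) : bool :=
  [forall i, exists j, outcome f j == Some i].

Definition parking_function := {f : preferences | is_parking f}.

Fact parked (f : parking_function) (i : 'I_n) :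
  exists j, outcome (val f) j == Some i.
Proof. by apply/existsP; move: i; apply/forallP; exact: (valP f). Qed.

Definition space_of (f : parking_function) (i : 'I_n) : 'I_n :=
  xchoose (parked f i).

Lemma space_ofP (f : parking_function) (i : 'I_n) :
  outcome (val f) (space_of f i) = Some i.
Proof. exact/eqP/(xchooseP (parked f i)). Qed.

Fact space_of_inj (f : parking_function) : injective (space_of f).
Proof.
by move=> i j eq_ij; apply: Some_inj; rewrite -!(space_ofP f) eq_ij.
Qed.

(* The permutation sending each space to the car parked there; see parkingTP. *)
Definition parkingT (f : parking_function) : {perm 'I_n} :=
  ((perm (@space_of_inj f))^-1)%g.

Lemma parkingTP (f : parking_function) (j : 'I_n) :
  outcome (val f) j = Some (parkingT f j).
Proof.
rewrite -{1}(permKV (perm (@space_of_inj f)) j) permE.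
exact: space_ofP.
Qed.

Definition Ppark1 (s : {perm 'I_n}) : rat :=
  #|parkingT @^-1: [set s]|%:R / #|{: parking_function}|%:R.

Definition Ppark (A : {set {perm 'I_n}}) : rat := \sum_(s in A) Ppark1 s.

End Parking.

(* Main.v *)
Require Import Defs.
From mathcomp Require Import all_boot all_order all_fingroup all_algebra.
From mathcomp Require Import zify ring.

Set Implicit Arguments.
Unset Strict Implicit.
Unset Printing Implicit Defensive.

(** Which spaces are occupied depends on the preferences only through the
    numbers [below f t] of cars that prefer one of the first t spaces.  The
    reason is that no car drives past a space that remains free: if space j is
    free in the end, the cars that prefer a space <= j are exactly those parked
    before j.  Hence (with spaces numbered from 0)
    - all n cars park if and only if [below f t >= t] for t <= n
      ([is_parking_xparking]);
    - the last car parks in space k if and only if it prefers a space <= k and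
      the other cars leave exactly space k free, which says that k of them form
      a parking function on the k spaces before k and the others form one on
      the n - 1 - k spaces after k ([last_car_parks_at],
      [leaves_free_split]).

    Both counts come from one formula: for m cars and an integer x, the number
    of x-parking functions, those preferences for which the m cars all park in
    x + m - 1 spaces, is x (x + m)^(m-1) ([card_xparking]).  Its proof removes
    the set S of cars that prefer one of the first x spaces.  Their choices are
    free, and the remaining preferences form an #|S|-parking function on the
    spaces after x, so that by induction the number is the sum over s of
    C(m, s) x^s s m^(m-s-1), which the binomial theorem evaluates.

    With x = 1 there are (n+1)^(n-1) parking functions.  Counting the position k
    from 1 as in the theorem, the last car has k preferences that lead to
    space k, C(n-1, k-1) is the number of choices of the k - 1 cars that park
    before k, and these and the n - k other cars have k^(k-2) and
    (n-k+1)^(n-k-1) possible preferences. *)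

(** * Splitting a function along a set of arguments *)

Lemma card_sig_pred (T : finType) (P Q : pred T) :
  #|[set u : {x | P x} | Q (val u)]| = #|[set x | P x && Q x]|.
Proof.
rewrite -(card_imset _ val_inj); apply: eq_card => x; rewrite !inE.
apply/imsetP/andP => [[u] | [Px Qx]].
  by rewrite inE => Qu ->; split=> //; apply: (valP u).
by exists (exist _ x Px); rewrite ?inE.
Qed.

Lemma card_setsig (I : finType) (S : {set I}) : #|{: {i | i \in S}}| = #|S|.
Proof. by rewrite card_sig; apply: eq_card. Qed.

Section Restriction.
Variables (I V : finType).
Implicit Types (S : {set I}) (f : {ffun I -> V}).

Definition restrict S f : {ffun {i | i \in S} -> V} := [ffun u => f (val u)].

(** A condition that is the conjunction of one on the values in S and one on
    the values outside S is satisfied by a product set, because a function is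
    the same as the pair of its two restrictions. *)
Lemma card_split S (P : pred {ffun I -> V})
    (P1 : pred {ffun {i | i \in S} -> V})
    (P2 : pred {ffun {i | i \in ~: S} -> V}) :
  (forall f, P f = P1 (restrict S f) && P2 (restrict (~: S) f)) ->
  #|[set f | P f]| = #|[set g | P1 g]| * #|[set h | P2 h]|.
Proof.
move=> PE; pose r f := (restrict S f, restrict (~: S) f).
have r_inj : injective r.
  move=> f g [/ffunP e1 /ffunP e2]; apply/ffunP => i.
  have [iS | iS] := boolP (i \in S).
    by move: (e1 (exist _ i iS)); rewrite !ffunE.
  rewrite -in_setC in iS.
  by move: (e2 (exist _ i iS)); rewrite !ffunE.
have r_bij : bijective r.
  (* Equal cardinals spare the construction of the inverse. *)
  apply: inj_card_bij r_inj _.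
  by rewrite card_prod !card_ffun -expnD !card_setsig cardsC.
rewrite -cardsX -(on_card_preimset (onW_bij _ r_bij)).
by apply: eq_card => f; rewrite !inE /= PE.
Qed.

End Restriction.

(** * The number of x-parking functions *)

Definition below (I : finType) N (f : {ffun I -> 'I_N}) t :=
  #|[set i | f i < t]|.

Section Below.
Variables (I : finType) (N : nat).
Implicit Types (S : {set I}) (f : {ffun I -> 'I_N}).

Lemma below_restrict S f t :
  below (restrict S f) t = #|[set i in S | f i < t]|.
Proof.
rewrite -(card_sig_pred (mem S) (fun i => f i < t)).
by apply: eq_card => u; rewrite !inE ffunE.
Qed.

Lemma below_split S f t :
  below f t = below (restrict S f) t + below (restrict (~: S) f) t.
Proof.
rewrite !below_restrict /below -(cardsID S); congr (_ + _); apply: eq_card => i.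
  by rewrite !inE andbC.
by rewrite !inE.
Qed.

Lemma leq_below f t u : t <= u -> below f t <= below f u.
Proof.
by move=> tu; apply: subset_leq_card; apply/subsetP=> i; rewrite !inE => /leq_trans->.
Qed.

Lemma below0 f t : (forall i, t <= f i) -> below f t = 0.
Proof. by move=> h; apply: eq_card0 => i; rewrite !inE ltnNge h. Qed.

Lemma belowT f t : (forall i, f i < t) -> below f t = #|I|.
Proof. by move=> h; apply: eq_card => i; rewrite !inE h. Qed.

(** The preferences of m = #|I| cars are x-parking functions when all m cars
    can park on a street with x + m - 1 spaces, equivalently when the j-th
    smallest preference, with j counted from 0, is less than x + j.  Here the
    street begins at space o, and all preferences are shifted by o.  The bound N on the values only has to exceed
    all the spaces, so that removing cars does not change the type. *)
Definition xparking o x f :=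
  [forall i, o <= f i] && [forall j : 'I_#|I|, j < below f (o + x + j)].

Lemma xparkingP o x f :
  reflect ((forall i, o <= f i) /\
           (forall j, j < #|I| -> j < below f (o + x + j)))
          (xparking o x f).
Proof.
apply: (iffP andP) => [[/forallP ge_o /forallP cnt] | [ge_o cnt]]; split=> //.
- by move=> j ltj; apply: (cnt (Ordinal ltj)).
- exact/forallP.
- by apply/forallP => j; apply: cnt.
Qed.

End Below.

Lemma card_interval N o x : o + x <= N -> #|[pred v : 'I_N | o <= v < o + x]| = x.
Proof.
move=> le_N; have le_oxj (j : 'I_x) : o + j < N by have := ltn_ord j; lia.
pose shift j := Ordinal (le_oxj j).
have shift_inj : injective shift by move=> j j' [/addnI/ord_inj].
rewrite -[RHS]card_ord -(card_imset _ shift_inj).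
apply: eq_card => v; rewrite inE; apply/idP/imsetP => [v_in | [j _ ->] /=].
  have lt_v : v - o < x by lia.
  by exists (Ordinal lt_v) => //; apply: val_inj => /=; lia.
by have := ltn_ord j; lia.
Qed.

(** The first #|S| inequalities of the definition hold as soon as #|S| cars
    prefer a space below o + x; the others, shifted by #|S|, are those of an #|S|-parking function starting at o + x. *)
Lemma xparking_split (I : finType) N o x (S : {set I}) (f : {ffun I -> 'I_N}) :
    S != set0 ->
  ([set i | f i < o + x] == S) && xparking o x f =
  (restrict S f \in ffun_on [pred v : 'I_N | o <= v < o + x]) &&
  xparking (o + x) #|S| (restrict (~: S) f).
Proof.
move=> S_n0; have S_gt0 : 0 < #|S| by rewrite card_gt0.
have cI : #|{: {i | i \in ~: S}}| = #|I| - #|S|.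
  by rewrite card_sig -(cardsC S) addKn; apply: eq_card.
have leS := max_card S.
apply/andP/andP => [[/eqP defS /xparkingP[ge_o cnt]] | [/ffun_onP onS /xparkingP[ge_ox cnt]]].
  have ltS u : u \in S -> f u < o + x by rewrite -defS inE.
  have geS u : u \in ~: S -> o + x <= f u by rewrite -defS !inE -leqNgt.
  have cS t : o + x <= t -> below (restrict S f) t = #|S|.
    move=> le_t; rewrite belowT ?card_setsig // => u.
    by rewrite ffunE (leq_trans (ltS _ (valP u))).
  split; first by apply/ffun_onP => u; rewrite inE ffunE ge_o ltS //; apply: (valP u).
  apply/xparkingP; split=> [u | j].
    by rewrite ffunE geS //; apply: (valP u).
  rewrite cI => ltj; have := cnt (#|S| + j); rewrite (below_split S) cS ?addnA; lia.
have ltS u : u \in S -> o <= f u < o + x.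
  by move=> uS; move: (onS (exist _ u uS)); rewrite ffunE.
have geS u : u \notin S -> o + x <= f u.
  rewrite -in_setC => uS; by move: (ge_ox (exist _ u uS)); rewrite ffunE.
split.
  apply/eqP/setP => i; rewrite inE; have [/ltS/andP[]//|/geS] := boolP (i \in S).
  by rewrite leqNgt => /negbTE.
apply/xparkingP; split=> [i | j ltj].
  have [/ltS/andP[]//|/geS] := boolP (i \in S).
  exact: leq_trans (leq_addr _ _).
have cS : below (restrict S f) (o + x + j) = #|S|.
  rewrite belowT ?card_setsig // => u; rewrite ffunE.
  case/andP: (ltS _ (valP u)) => _ /leq_trans-> //; exact: leq_addr.
rewrite (below_split S) cS.
have [?|leSj] := ltnP j #|S|; first lia.
have := cnt (j - #|S|); rewrite cI.
have -> : o + x + #|S| + (j - #|S|) = o + x + j by lia.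
lia.
Qed.

Lemma sum_by_card (I : finType) (F : nat -> nat) :
  \sum_(S : {set I}) F #|S| = \sum_(s < #|I|.+1) 'C(#|I|, s) * F s.
Proof.
rewrite (partition_big (fun S : {set I} => inord #|S| : 'I_(#|I|.+1)) predT) //=.
apply: eq_bigr => s _; rewrite -(card_draws I s) -sum_nat_const.
have card_inord (S : {set I}) : (inord #|S| == s) = (#|S| == s :> nat) :> bool.
  by rewrite -val_eqE /= inordK // ltnS max_card.
by apply: eq_big => S; rewrite ?inE card_inord // => /eqP ->.
Qed.

(** The factor x + #|I| on the left avoids the exponent #|I| - 1, which would
    be -1 when there are no cars. *)
Lemma card_xparking (I : finType) N o x :
    o + x + #|I| <= N.+1 ->
  (x + #|I|) * #|[set f : {ffun I -> 'I_N} | xparking o x f]| =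
  x * (x + #|I|) ^ #|I|.
Proof.
have [m] := ubnP #|I|; elim: m I o x => // m IH I o x ltIm le_N.
have [I0 | I_gt0] := posnP #|I|.
  rewrite I0 addn0 expn0.
  suff -> : #|[set f : {ffun I -> 'I_N} | xparking o x f]| = 1 by [].
  transitivity #|{: {ffun I -> 'I_N}}|; last by rewrite card_ffun I0.
  apply: eq_card => f; rewrite !inE; apply/xparkingP; rewrite I0; split=> // i.
  by have := card0_eq I0 i; rewrite !inE.
set Q := #|_|.
(* Multiplying by #|I| brings the counts for the complements of the sets S,
   given by induction, to the form without a negative exponent. *)
suff mQ : #|I| * Q = #|I| * (x * (x + #|I|) ^ #|I|.-1).
  move/eqP: mQ; rewrite eqn_pmul2l // => /eqP ->.
  by rewrite mulnCA -expnS prednK.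
(* S = set0 is impossible: some car must prefer one of the first x spaces. *)
have -> : Q = \sum_(S : {set I} | S != set0)
   #|[set f : {ffun I -> 'I_N} | ([set i | f i < o + x] == S) && xparking o x f]|.
  rewrite /Q -sum1_card.
  rewrite (partition_big (fun f : {ffun I -> 'I_N} => [set i | f i < o + x])
             (fun S => S != set0)) /=.
    apply: eq_bigr => S _; rewrite -sum1_card; apply: eq_bigl => f.
    by rewrite !inE andbC.
  move=> f; rewrite inE => /xparkingP[_ /(_ 0 I_gt0)].
  by rewrite addn0 -card_gt0.
rewrite big_distrr /=.
have step (S : {set I}) : S != set0 ->
   #|I| * #|[set f : {ffun I -> 'I_N} | ([set i | f i < o + x] == S) && xparking o x f]|
   = x ^ #|S| * (#|S| * #|I| ^ (#|I| - #|S|)).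
  move=> S_n0; rewrite (card_split (S := S) (fun f => xparking_split o x f S_n0)).
  rewrite mulnCA; congr (_ * _).
    rewrite cardsE card_ffun_on card_interval ?card_setsig //; lia.
  have cI : #|{: {i | i \in ~: S}}| = #|I| - #|S|.
    by rewrite card_sig -(cardsC S) addKn; apply: eq_card.
  have leS := max_card S.
  have S_gt0 : 0 < #|S| by rewrite card_gt0.
  have := IH {i | i \in ~: S} (o + x) #|S|.
  rewrite cI subnKC //; apply; lia.
rewrite (eq_bigr _ step).
have -> : \sum_(S : {set I} | S != set0) x ^ #|S| * (#|S| * #|I| ^ (#|I| - #|S|))
  = \sum_(S : {set I}) x ^ #|S| * (#|S| * #|I| ^ (#|I| - #|S|)).
  by rewrite [RHS](bigD1 set0) //= cards0 mul0n muln0 add0n.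
rewrite (sum_by_card _ (fun s => x ^ s * (s * #|I| ^ (#|I| - s)))).
rewrite big_ord_recl mul0n !muln0 add0n.
have -> : #|I| = #|I|.-1.+1 by rewrite prednK.
set p := #|I|.-1; rewrite /= (addnC x) expnDn !big_distrr /=.
apply: eq_bigr => s _; rewrite /bump /= add1n subSS expnS.
transitivity (s.+1 * 'C(p.+1, s.+1) * (x * (x ^ s * p.+1 ^ (p - s)))); first nia.
rewrite -mul_bin_diag /=; nia.
Qed.

(** * Preferences that leave a single space free *)

(** The criterion for n - 1 cars to occupy all of n spaces but space k: the
    first t spaces contain t - 1 or t spaces other than k, according to whether
    k is among them, and no car drives past k.  See [exactly_one_free]. *)
Definition leaves_free (I : finType) n k (g : {ffun I -> 'I_n}) :=
  [forall t : 'I_n.+1, t - (k < t) <= below g t] && (below g k.+1 <= k).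

Lemma leaves_freeP (I : finType) n k (g : {ffun I -> 'I_n}) :
  reflect ((forall t, t <= n -> t - (k < t) <= below g t) /\ below g k.+1 <= k)
          (leaves_free k g).
Proof.
apply: (iffP andP) => [[/forallP cnt le_k] | [cnt le_k]]; split=> //.
  by move=> t le_t; apply: (cnt (Ordinal (le_t : t < n.+1))).
by apply/forallP => t; apply: cnt; rewrite -ltnS.
Qed.

Section LeavesFree.
Variables (I : finType) (n k : nat).
Hypotheses (cardI : #|I| = n.-1) (lt_kn : k < n).
Implicit Types (g : {ffun I -> 'I_n}) (S : {set I}).

Lemma leaves_free_card g : leaves_free k g -> #|[set i | g i < k]| = k.
Proof.
case/leaves_freeP => cnt le_k; apply/eqP; rewrite -[#|_|]/(below g k) eqn_leq.
rewrite (leq_trans (leq_below g (leqnSn k)) le_k) /=.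
by have := cnt k (ltnW lt_kn); rewrite ltnn subn0.
Qed.

(** Space k cuts the street into two independent parking problems, for the k
    cars that prefer a space before k and for those that prefer a space after
    k. *)
Lemma leaves_free_split S g : #|S| = k ->
  ([set i | g i < k] == S) && leaves_free k g =
  xparking 0 1 (restrict S g) && xparking k.+1 1 (restrict (~: S) g).
Proof.
move=> cardS.
have cSC : #|{: {i | i \in ~: S}}| = n.-1 - k.
  by rewrite card_setsig -cardI -cardS -(cardsC S) addKn.
have cS : #|{: {i | i \in S}}| = k by rewrite card_setsig.
apply/andP/andP.
  case=> /eqP defS /leaves_freeP[cnt le_k].
  have ltS u : u \in S -> g u < k by rewrite -defS inE.
  have geS u : u \in ~: S -> k < g u.
    (* No car prefers k itself: the cars below k are already as many as the
       cars below k + 1. *)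
    move=> uS; have /eqP sameS : [set i | g i < k] == [set i | g i < k.+1].
      rewrite eqEcard -/(below g k.+1) {2}defS cardS le_k andbT.
      by apply/subsetP => i; rewrite !inE => /ltnW.
    by move: uS; rewrite -defS sameS !inE -ltnNge.
  have belowC t : t <= k.+1 -> below (restrict (~: S) g) t = 0.
    move=> le_t; apply: below0 => u; rewrite ffunE.
    exact: leq_trans le_t (geS _ (valP u)).
  have belowS t : k <= t -> below (restrict S g) t = k.
    move=> le_t; rewrite belowT // => u; rewrite ffunE.
    exact: leq_trans (ltS _ (valP u)) le_t.
  split; apply/xparkingP; split=> //.
  - move=> j; rewrite cS => ltj; have := cnt j.+1; rewrite (below_split S).
    by rewrite (belowC _ (ltnW (ltj : j.+1 < k.+1))) add0n add1n; lia.
  - by move=> u; rewrite ffunE; apply: geS (valP u).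
  - move=> j; rewrite cSC => ltj; have := cnt (k.+1 + 1 + j).
    by rewrite (below_split S) belowS; lia.
case=> /xparkingP[_ cntS] /xparkingP[geC cntC].
have geS u : u \in ~: S -> k < g u.
  by move=> uS; move: (geC (exist _ u uS)); rewrite ffunE.
have belowC t : t <= k.+1 -> below (restrict (~: S) g) t = 0.
  move=> le_t; apply: below0 => u; rewrite ffunE.
  exact: leq_trans le_t (geS _ (valP u)).
have ltS u : u \in S -> g u < k.
  (* The last inequality of [cntS], for j = k - 1, counts all the cars of S. *)
  move=> uS; have k_gt0 : 0 < k by rewrite -cardS card_gt0; apply/set0Pn; exists u.
  have := cntS k.-1; rewrite cS add0n add1n !prednK // => /(_ (leqnn _)) le_k.
  have /eqP full : [set v | restrict S g v < k] == setT.
    by rewrite eqEcard subsetT cardsT cS.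
  by have := in_setT (exist _ u uS : {i | i \in S}); rewrite -full inE ffunE.
have belowS t : k <= t -> below (restrict S g) t = k.
  move=> le_t; rewrite belowT // => u; rewrite ffunE.
  exact: leq_trans (ltS _ (valP u)) le_t.
split.
  apply/eqP/setP => i; rewrite inE; have [/ltS//|] := boolP (i \in S).
  by rewrite -in_setC => /geS/ltnW; rewrite leqNgt => /negbTE.
apply/leaves_freeP; split=> [t le_tn|]; rewrite (below_split S); last first.
  by rewrite belowC // belowS ?leqnSn // addn0.
have [lt_kt|le_tk] := ltnP k t.
  rewrite belowS ?(ltnW lt_kt) //; have [?|lt_k1t] := leqP t k.+1; first lia.
  have := cntC (t - k.+2); rewrite cSC.
  have -> : k.+1 + 1 + (t - k.+2) = t by lia.
  lia.
case: t le_tn le_tk => // t le_tn le_tk; rewrite belowC; last lia.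
by have := cntS t; rewrite cS add0n add1n; lia.
Qed.

Lemma card_leaves_free :
  k.+1 * (n - k) * #|[set g : {ffun I -> 'I_n} | leaves_free k g]| =
  'C(n.-1, k) * (k.+1 ^ k * (n - k) ^ (n.-1 - k)).
Proof.
have -> : #|[set g : {ffun I -> 'I_n} | leaves_free k g]| =
  \sum_(S : {set I} | #|S| == k)
    #|[set g : {ffun I -> 'I_n} | ([set i | g i < k] == S) && leaves_free k g]|.
  rewrite -sum1_card (partition_big (fun g => [set i | g i < k])
                                    (fun S => #|S| == k)) /=.
    apply: eq_bigr => S _; rewrite -sum1_card; apply: eq_bigl => f.
    by rewrite !inE andbC.
  by move=> g; rewrite inE => /leaves_free_card ->.
rewrite big_distrr /= -cardI -card_draws -sum_nat_const.
apply: eq_big => [S | S /eqP cardS]; first by rewrite inE.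
rewrite (card_split (S := S) (fun g => leaves_free_split g cardS)).
have cSC : #|{: {i | i \in ~: S}}| = n.-1 - k.
  by rewrite card_setsig -cardI -cardS -(cardsC S) addKn.
have cS : #|{: {i | i \in S}}| = k by rewrite card_setsig.
have := @card_xparking {i | i \in S} n 0 1; rewrite cS add0n !add1n mul1n.
move=> <-; last lia.
have := @card_xparking {i | i \in ~: S} n k.+1 1; rewrite cSC mul1n.
have -> : 1 + (n.-1 - k) = n - k by lia.
by rewrite cardI => <-; [rewrite mulnACA | lia].
Qed.

End LeavesFree.

(** * The state of the street *)

Lemma targetP n (st : street n) (p : 'I_n) :
  match target st p with
  | Some j => [/\ st j = None, p <= j &
                 forall j' : 'I_n, st j' = None -> p <= j' -> j <= j']
  | None => forall j' : 'I_n, p <= j' -> st j' <> None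
  end.
Proof.
rewrite /target; case: eqP => [st_p | st_p]; first by split.
have: sorted (fun i j : 'I_n => i < j)
         [seq j <- enum 'I_n | (st j == None) && (p < j)].
  apply: sorted_filter; first by move=> ? ? ?; apply: ltn_trans.
  by have := iota_ltn_sorted 0 n; rewrite -val_enum_ord sorted_map.
have mem_free j : (j \in [seq j <- enum 'I_n | (st j == None) && (p < j)]) =
    (st j == None) && (p < j) by rewrite mem_filter mem_enum andbT.
have free_gt j : st j = None -> p <= j -> (st j == None) && (p < j).
  move=> st_j; rewrite st_j eqxx leq_eqVlt => /orP[/eqP/ord_inj pj|//].
  by case: st_p; rewrite pj.
case: [seq j <- enum 'I_n | _] mem_free => [|j s] /= mem_free.
  by move=> _ j' le_pj st_j; have := free_gt j' st_j le_pj; rewrite -mem_free.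
rewrite path_sortedE; last by move=> ? ? ?; apply: ltn_trans.
case/andP => /allP min_j _; have := mem_free j; rewrite mem_head.
case/esym/andP => /eqP st_j /ltnW le_pj; split=> // j' st_j' le_pj'.
have := free_gt j' st_j' le_pj'; rewrite -mem_free inE.
by case/orP => [/eqP -> // | /min_j/ltnW].
Qed.

Section Dynamics.
Variables (n : nat) (f : preferences n).
Implicit Types (st : street n) (L : {set 'I_n}).

(** The invariant of the parking process after the arrival of the cars in L.
    The last clause says that no car of L has passed or missed a free space; it
    covers both the cars that parked and those that left the street. *)
Record reachable L st : Prop := Reachable {
  parked_pref : forall i j, st j = Some i -> i \in L /\ f i <= j;
  parked_once : forall i j j', st j = Some i -> st j' = Some i -> j = j';
  free_barrier : forall i j, i \in L -> st j = None -> f i <= j ->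
    exists2 j' : 'I_n, j' < j & st j' = Some i }.

Lemma reachable_arrive L st i :
  reachable L st -> i \notin L -> reachable (i |: L) (arrive f st i).
Proof.
case=> pref once barrier iL; rewrite /arrive; have := targetP st (f i).
case: (target st (f i)) => [j0 | full]; last first.
  split=> // [i' j /pref[i'L ?] | i' j]; first by rewrite inE i'L orbT.
  by case/setU1P => [-> | i'L] st_j le_j; [case: (full j) | apply: barrier].
case=> st_j0 le_j0 first_j0; split=> [i' j | i' j j' | i' j].
- rewrite ffunE; case: eqP => [-> [<-] | _ /pref[i'L ?]].
    by rewrite inE set11.
  by rewrite inE i'L orbT.
- rewrite !ffunE; case: eqP => [-> | _]; case: eqP => [-> // | _].
  + by case=> <- /pref[]; rewrite (negbTE iL).
  + by move=> st_j [e]; move: st_j; rewrite -e => /pref[]; rewrite (negbTE iL).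
  + exact: once.
rewrite ffunE; case: eqP => // ne_j i'L st_j le_j.
case/setU1P: i'L => [e | i'L].
  exists j0; last by rewrite ffunE eqxx e.
  rewrite ltn_neqAle; apply/andP; split.
    by apply/eqP => /ord_inj ej; apply: ne_j.
  by apply: first_j0; rewrite // -e.
have [j' lt_j' st_j'] := barrier i' j i'L st_j le_j.
exists j' => //; rewrite ffunE; case: eqP => // ej.
by move: st_j'; rewrite ej st_j0.
Qed.

Lemma reachable_foldl (l : seq 'I_n) :
  uniq l -> reachable [set i in l] (foldl (arrive f) [ffun=> None] l).
Proof.
elim/last_ind: l => [_ | l i IHl].
  by split=> [i j | i j j' | i j]; rewrite ?ffunE ?inE.
rewrite rcons_uniq => /andP[iNl /IHl reach_l].
rewrite foldl_rcons.
have -> : [set i' in rcons l i] = i |: [set i' in l].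
  by apply/setP => i'; rewrite !inE mem_rcons in_cons.
by apply: reachable_arrive; rewrite ?inE.
Qed.

Lemma card_lt (t : nat) : t <= n -> #|[set j : 'I_n | j < t]| = t.
Proof.
move=> le_tn; rewrite -[RHS](@card_interval n 0 t) //.
by apply: eq_card => j; rewrite !inE.
Qed.

Section Reachable.
Variables (L : {set 'I_n}) (st : street n).
Hypothesis reach : reachable L st.

(** Every car parks at or after its preferred space. *)
Lemma occupied_le (t : nat) :
  #|[set j : 'I_n | (j < t) && (st j != None)]| <= #|[set i in L | f i < t]|.
Proof.
rewrite -[leqRHS](card_imset _ (@Some_inj _)) -(card_in_imset (f := st)).
  apply/subset_leq_card/subsetP => _ /imsetP[j + ->]; rewrite inE => /andP[lt_j].
  case st_j: (st j) => [i|] // _; apply: imset_f; rewrite inE.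
  by have [-> le_j] := parked_pref reach st_j; apply: leq_ltn_trans lt_j.
move=> j j'; rewrite !inE => /andP[_ +] /andP[_ _].
case st_j: (st j) => [i|] // _ e; exact: parked_once reach _ _ _ st_j (esym e).
Qed.

(** No car drives past a free space. *)
Lemma occupied_ge (j : 'I_n) : st j = None ->
  #|[set i in L | f i <= j]| <= #|[set j' : 'I_n | (j' < j) && (st j' != None)]|.
Proof.
move=> st_j; rewrite -(card_imset _ (@Some_inj _)).
apply: leq_trans (leq_imset_card st _); apply/subset_leq_card/subsetP => _ /imsetP[i + ->].
rewrite inE => /andP[iL le_j].
have [j' lt_j' st_j'] := free_barrier reach iL st_j le_j.
by rewrite -st_j'; apply: imset_f; rewrite inE lt_j' st_j'.
Qed.

Lemma all_occupied_le (t : nat) : t <= n ->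
  (forall j : 'I_n, j < t -> st j != None) -> t <= #|[set i in L | f i < t]|.
Proof.
move=> le_tn occ; rewrite -{1}(card_lt le_tn); apply: leq_trans (occupied_le t).
by apply/subset_leq_card/subsetP=> j; rewrite !inE => lt_j; rewrite lt_j occ.
Qed.

Lemma free_le (j : 'I_n) : st j = None -> #|[set i in L | f i <= j]| <= j.
Proof.
move=> st_j; apply: leq_trans (occupied_ge st_j) _.
rewrite -{2}(card_lt (ltnW (ltn_ord j))).
by apply/subset_leq_card/subsetP=> j'; rewrite !inE => /andP[].
Qed.

Lemma reachable_full : (forall j, st j != None) ->
  forall i, exists j, st j == Some i.
Proof.
move=> occ; have st_inj : injective st.
  move=> j j' e; have := occ j; case st_j: (st j) => [i|] // _.
  exact: (parked_once reach st_j (etrans (esym e) st_j)).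
move=> i; have sub : st @: 'I_n \subset Some @: 'I_n.
  apply/subsetP => _ /imsetP[j _ ->]; have := occ j; case: (st j) => [i'|] // _.
  exact: imset_f.
have /eqP same : st @: 'I_n == Some @: 'I_n.
  by rewrite eqEcard sub !card_imset ?leqnn //; apply: Some_inj.
have : Some i \in Some @: 'I_n by apply: imset_f.
by rewrite -same => /imsetP[j _ ->]; exists j.
Qed.

(** If k is the only free space, the occupied spaces among the first t are
    known and are bounded by [occupied_le].  Conversely, a free space j other
    than k would by [occupied_ge] leave too few cars with preferences <= j. *)
Lemma exactly_one_free (k : 'I_n) :
  reflect (st k = None /\ forall j, j != k -> st j != None)
          (leaves_free k (restrict L f)).
Proof.
have belowE t : #|[set i in L | f i < t]| = below (restrict L f) t.
  by rewrite below_restrict.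
have card_ltD1 (t : nat) : k < t -> t <= n ->
    #|[set j : 'I_n | j < t] :\ k| = t.-1.
  move=> lt_kt le_t; have := cardsD1 k [set j : 'I_n | j < t].
  by rewrite card_lt // inE lt_kt => /(congr1 predn) ->.
apply: (iffP (leaves_freeP _ _)) => [[cnt le_k] | [st_k occ]].
  have below_k (j : 'I_n) : j < k -> st j != None.
    move=> lt_jk; apply/eqP => /free_le; rewrite (belowE j.+1).
    by have := cnt j.+1 (ltn_ord j); lia.
  have st_k : st k = None.
    apply/eqP/negPn/negP => occ_k.
    have : k.+1 <= #|[set i in L | f i < k.+1]|.
      apply: all_occupied_le => // j; rewrite ltnS leq_eqVlt.
      by case/orP => [/eqP/ord_inj-> | /below_k].
    by rewrite belowE ltnNge le_k.
  split=> // j ne_jk; have [/below_k //|lt_kj|/ord_inj e] := ltngtP j k; last first.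
    by rewrite e eqxx in ne_jk.
  apply/eqP => st_j; have := occupied_ge st_j; rewrite (belowE j.+1).
  have : #|[set j' : 'I_n | (j' < j) && (st j' != None)]| <= j.-1.
    rewrite -(card_ltD1 j lt_kj (ltnW (ltn_ord j))).
    apply/subset_leq_card/subsetP => j'; rewrite !inE => /andP[-> occ].
    by rewrite andbT; apply: contraNneq occ => ->; rewrite st_k.
  by have := cnt j.+1 (ltn_ord j); lia.
split=> [t le_t|]; last by rewrite -belowE; apply: free_le.
rewrite -belowE; have [lt_kt|le_tk] := ltnP k t.
  rewrite subn1 -(card_ltD1 t lt_kt le_t).
  apply: leq_trans (occupied_le t).
  by apply/subset_leq_card/subsetP => j; rewrite !inE => /andP[/occ-> ->].
rewrite subn0; apply: all_occupied_le => // j lt_jt.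
by apply: occ; rewrite neq_ltn (leq_trans lt_jt).
Qed.

End Reachable.

Lemma reachable_outcome : reachable setT (outcome f).
Proof.
have -> : [set: 'I_n] = [set i in enum 'I_n].
  by apply/setP => i; rewrite !inE mem_enum.
exact: reachable_foldl (enum_uniq _).
Qed.

(** There are as many cars as spaces. *)
Lemma is_parking_full : is_parking f = [forall j, outcome f j != None].
Proof.
have reach := reachable_outcome.
apply/forallP/forallP => [park | full i]; last first.
  by apply/existsP; apply: reachable_full reach full i.
set D := [set j | outcome f j != None].
have leD : n <= #|D|.
  apply: leq_trans (leq_imset_card (outcome f) D).
  rewrite -{1}(card_ord n) -[leqLHS](card_imset _ (@Some_inj _)).
  apply/subset_leq_card/subsetP => _ /imsetP[i _ ->].
  have /existsP[j /eqP e] := park i.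
  by rewrite -e; apply: imset_f; rewrite inE e.
have /eqP DT : D == setT by rewrite eqEcard subsetT cardsT card_ord.
by move=> j; have := in_setT j; rewrite -DT inE.
Qed.

(** With x = 1 there are as many spaces as cars. *)
Lemma is_parking_xparking : is_parking f = xparking 0 1 f.
Proof.
have reach := reachable_outcome.
have belowE t : #|[set i in setT | f i < t]| = below f t.
  by apply: eq_card => i; rewrite !inE.
rewrite is_parking_full.
apply/forallP/xparkingP => [full | [_ cnt] j].
  split=> // j; rewrite card_ord add0n add1n => ltj.
  by rewrite -belowE; apply: (all_occupied_le reach).
apply/eqP => /(free_le reach); rewrite (belowE j.+1).
by have := cnt j; rewrite card_ord add0n add1n => /(_ (ltn_ord j)); lia.
Qed.

End Dynamics.

(** The last car finds the street as its predecessors left it.  It completes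
    the street by parking in space k exactly when k is the only free space and
    it does not prefer a later one. *)
Lemma last_car_parks_at n (f : preferences n.+1) (k : 'I_n.+1) :
  is_parking f && (outcome f k == Some ord_max) =
  (f ord_max <= k) && leaves_free k (restrict (~: [set ord_max]) f).
Proof.
set L := ~: [set ord_max].
pose l := map (widen_ord (leqnSn n)) (enum 'I_n).
have mem_l i : (i \in l) = (i != ord_max).
  apply/mapP/idP => [[j _ ->] | ne_i].
    by rewrite -val_eqE /= neq_ltn ltn_ord.
  have lt_i : i < n.
    by rewrite ltn_neqAle -ltnS ltn_ord andbT; move: ne_i; rewrite -val_eqE.
  by exists (Ordinal lt_i); [rewrite mem_enum | apply: val_inj].
have uniq_l : uniq l.
  rewrite map_inj_uniq ?enum_uniq // => i j.
  by move/(congr1 (@nat_of_ord n.+1)) => e; apply: ord_inj; exact: e.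
have reach := reachable_foldl f uniq_l.
have outE : outcome f = arrive f (foldl (arrive f) [ffun=> None] l) ord_max.
  by rewrite /outcome enum_ordSr foldl_rcons.
have setlE : [set i in l] = L by apply/setP => i; rewrite !inE mem_l.
rewrite setlE in reach.
set st := foldl _ _ l in reach outE.
have stN j : (st j == Some ord_max) = false.
  by apply/eqP => /(parked_pref reach)[]; rewrite !inE eqxx.
have one_free := exactly_one_free reach k.
rewrite is_parking_full outE /arrive; have := targetP st (f ord_max).
case: (target st (f ord_max)) => [j0 [st_j0 le_j0 _] | full]; last first.
  rewrite stN andbF; apply/esym/negP => /andP[le_k /one_free[st_k _]].
  exact: full k le_k st_k.
apply/andP/andP => [[/forallP full] | [le_k /one_free[st_k occ]]].
  rewrite ffunE; case: (eqVneq k j0) => [e _ | _]; last by rewrite stN.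
  split; rewrite e // -e; apply/one_free; split=> [|j ne_j]; first by rewrite e.
  by have := full j; rewrite ffunE -e (negbTE ne_j).
have e : j0 = k by apply/eqP; apply: contraT => /occ; rewrite st_j0.
split; last by rewrite ffunE e eqxx.
by apply/forallP => j; rewrite ffunE e; case: (eqVneq j k) => // /occ.
Qed.

(** * Counting *)

Lemma card_parking n : 0 < n -> #|{: parking_function n}| = n.+1 ^ n.-1.
Proof.
move=> n_gt0; rewrite card_sig.
have -> : #|[pred f : preferences n | is_parking f]| =
          #|[set f : {ffun 'I_n -> 'I_n} | xparking 0 1 f]|.
  by apply: eq_card => f; rewrite !inE is_parking_xparking.
have := @card_xparking 'I_n n 0 1; rewrite card_ord add0n add1n mul1n.
have -> : n.+1 ^ n = n.+1 * n.+1 ^ n.-1 by rewrite -expnS prednK.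
by move=> /(_ (leqnn _)) /eqP; rewrite eqn_pmul2l // => /eqP.
Qed.

(** As in [card_xparking], the factor n.+1 - k avoids the exponent -1, which
    occurs for k = n. *)
Lemma card_last_car n (k : 'I_n.+1) :
  (n.+1 - k) * #|[set f : preferences n.+1 |
                   is_parking f && (outcome f k == Some ord_max)]| =
  'C(n, k) * (k.+1 ^ k * (n.+1 - k) ^ (n - k)).
Proof.
pose D := [pred v : 'I_n.+1 | 0 <= v < 0 + k.+1].
have splitE (f : preferences n.+1) :
    is_parking f && (outcome f k == Some ord_max) =
    (restrict [set ord_max] f \in ffun_on D) &&
    leaves_free k (restrict (~: [set ord_max]) f).
  rewrite last_car_parks_at; congr (_ && _).
  apply/idP/ffun_onP => [le_k u | /(_ (exist _ ord_max (set11 _)))].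
    by rewrite ffunE (set1P (valP u)) inE.
  by rewrite ffunE inE.
rewrite (card_split (S := [set ord_max]) splitE) cardsE card_ffun_on.
rewrite card_setsig cards1 expn1 card_interval; last exact: (ltn_ord k).
have cJ : #|{: {i : 'I_n.+1 | i \in ~: [set ord_max]}}| = n.+1.-1.
  by rewrite card_setsig cardsC1 card_ord.
by rewrite mulnA [_ * k.+1]mulnC (card_leaves_free cJ (ltn_ord k)).
Qed.

(** * The distribution of the space of the last car *)

Import Order.TTheory GRing.Theory Num.Theory.

Local Open Scope ring_scope.

Lemma Ppark_card n (A : {set {perm 'I_n}}) :
  Ppark A = #|[set f : parking_function n | parkingT f \in A]|%:R
            / #|{: parking_function n}|%:R.
Proof.
rewrite /Ppark /Ppark1 -mulr_suml -natr_sum; congr (_%:R / _).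
rewrite -sum1_card (partition_big (@parkingT n) (mem A)) /=; last first.
  by move=> f; rewrite inE.
apply: eq_bigr => s sA; rewrite -sum1_card; apply: eq_bigl => f.
by rewrite !inE; case: eqP => [-> | _]; rewrite ?sA ?andbF.
Qed.

Lemma parkingT_inv n (f : parking_function n) (i j : 'I_n) :
  ((parkingT f)^-1%g i == j) = (outcome (val f) j == Some i).
Proof.
rewrite parkingTP (inj_eq (@Some_inj _)).
by rewrite (can2_eq (permKV _) (permK _)) eq_sym.
Qed.

Theorem corollary5 (n k : nat) (n_gt0 : (0 < n)%N) (k_in : (1 <= k <= n)%N) :
  Ppark [set s : {perm 'I_n} | label ((s^-1)%g (top n_gt0)) == k] =
    n%:R^-1 * k%:R ^+ k * 'C(n, k)%:R *
      ((n%:R - k%:R + 1) ^ (n%:Z - k%:Z - 1) / (n%:R + 1) ^+ (n - 1)).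
Proof.
case: n n_gt0 k_in => // n n_gt0; case: k => // k lt_kn.
have topE : top n_gt0 = ord_max by apply: val_inj.
pose k0 : 'I_n.+1 := Ordinal lt_kn.
rewrite Ppark_card card_parking //.
set c := #|_|; have cE : c = #|[set f : preferences n.+1 |
                       is_parking f && (outcome f k0 == Some ord_max)]|.
  rewrite -(card_sig_pred _ (fun f => outcome f k0 == Some ord_max)).
  apply: eq_card => f; rewrite !inE -parkingT_inv topE.
  by rewrite /label eqSS -val_eqE.
have := card_last_car k0; rewrite -cE /= => /(congr1 (fun m => m%:R : rat)).
have le_kn : (k <= n)%N by [].
rewrite !natrM !natrX => countE.
have nk_neq0 : (n.+1 - k)%:R != 0 :> rat by rewrite pnatr_eq0; lia.
have -> : c%:R = 'C(n, k)%:R * (k.+1%:R ^+ k * (n.+1 - k)%:R ^+ (n - k))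
                 / (n.+1 - k)%:R :> rat.
  by rewrite -countE mulrAC mulfV // mul1r.
have -> : n.+1%:R - k.+1%:R + 1 = (n.+1 - k)%:R :> rat.
  by rewrite natrB 1?leqW // -!natr1; ring.
have -> : n.+1%:Z - k.+1%:Z - 1 = (n - k)%N%:Z - 1 by lia.
rewrite expfzDr // exprN1 -exprnP subn1 /= natr1.
have binE : n.+1%:R * 'C(n, k)%:R = k.+1%:R * 'C(n.+1, k.+1)%:R :> rat.
  by rewrite -!natrM -mul_bin_diag.
have -> : 'C(n, k)%:R = n.+1%:R^-1 * (k.+1%:R * 'C(n.+1, k.+1)%:R) :> rat.
  by rewrite -binE mulKf // pnatr_eq0.
by rewrite exprS; ring.
Qed.
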